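(* Let $X_1,\dots,X_N$ be independent random variables with values in $[0,1]$, identically distributed according to a given law $\mu$. Let $M$ be a median of $B_N(X_1,\dots,X_N)$. Then for all $0\le u\le4\sqrt2\,N\,EX_1^2$, $$P(|B_N(X_1,\dots,X_N)-M|\ge1+u)\le8\exp\Big(-\frac{u^2}{16N\,EX_1^2}\Big).$$
   Context: Given items with sizes $x_1,\dots,x_N\in[0,1]$, $B_N(x_1,\dots,x_N)$ denotes the minimum number of unit-size bins in which the items can be packed, subject to the restriction that the sum of the sizes of the items attributed to a given bin does not exceed one. *)

(* Defs.v *)
From HB Require Import structures.
From mathcomp Require Import all_boot all_order all_algebra.
From mathcomp Require Import all_classical all_reals all_analysis.

Set Implicit Arguments.
Unset Strict Implicit.
Unset Printing Implicit Defensive.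

Import Order.TTheory GRing.Theory Num.Theory.
Import numFieldNormedType.Exports.

Local Open Scope classical_set_scope.
Local Open Scope ring_scope.

Definition packable (R : realType) (N : nat) (x : 'I_N -> R) (k : nat) : bool :=
  [exists f : {ffun 'I_N -> 'I_k},
    [forall j : 'I_k, \sum_(i < N | f i == j) x i <= 1]].

(* Sizes in [0, 1] can always be packed in N bins, one item per bin, so it is
   enough to minimize over k <= N. If N bins do not suffice, which only happens
   for sizes outside [0, 1], [arg min] returns the default value N. *)
Definition bin_packing_number (R : realType) (N : nat) (x : 'I_N -> R) : nat :=
  [arg min_(k < (ord_max : 'I_N.+1) | packable x k) (k : nat)]%N.

Lemma packable_size (R : realType) (N : nat) (x : 'I_N -> R) :
  (forall i, 0 <= x i <= 1) -> packable x N.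
Proof.
move=> x01; apply/existsP; exists [ffun i => i]; apply/forallP => j.
rewrite (eq_bigl (pred1 j)); last by move=> i; rewrite ffunE.
by rewrite big_pred1_eq; case/andP: (x01 j).
Qed.

Lemma bin_packing_numberP (R : realType) (N : nat) (x : 'I_N -> R) :
  (forall i, 0 <= x i <= 1) ->
  packable x (bin_packing_number x) /\
  forall k, packable x k -> (bin_packing_number x <= k)%N.
Proof.
move=> x01; rewrite /bin_packing_number.
case: arg_minnP => [|k pk kmin]; first exact: packable_size.
split=> // l pl; have [lN|Nl] := ltnP l N.+1; first exact: (kmin (Ordinal lN)).
by apply: leq_trans (ltnW Nl); rewrite -ltnS ltn_ord.
Qed.

Definition mutually_independent d (T : measurableType d) (R : realType)
    (P : probability T R) (I : finType) (X : I -> {RV P >-> R}) : Prop :=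
  forall (J : {set I}) (A : I -> set R), (forall i, measurable (A i)) ->
    P (\bigcap_(i in [set` J]) X i @^-1` A i) =
      (\prod_(i in J) P (X i @^-1` A i))%E.

(* The laws are compared on measurable sets only: the library's measures are
   functions on all sets, with arbitrary values off the sigma-algebra. *)
Definition has_law d (T : measurableType d) (R : realType)
    (P : probability T R) (X : {RV P >-> R})
    (mu : probability R R) : Prop :=
  forall A : set R, measurable A -> distribution P X A = mu A.

Definition is_median d (T : measurableType d) (R : realType)
    (P : probability T R) (Y : T -> R) (m : R) : Prop :=
  ((2^-1)%:E <= P [set w | (Y w <= m)%R])%E /\
  ((2^-1)%:E <= P [set w | (m <= Y w)%R])%E.

(* Main.v *)
(* If the items on which x differs from y have total size D and B(x) - B(y) >= 2,
   then B(x) - B(y) <= 2 D: repack these items separately,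
   two bins of an optimal packing always containing more than 1 together. It
   remains to control the weighted Hamming distance d(x, y) = sum of the x_i with
   x_i <> y_i. For sets S and A such that d >= r on S x A, and for a > 0, induction
   on the number of coordinates gives
     exp (a b r) P(S) P(A)^a <= exp (sum_i E tau(X_i))
   as soon as exp (a y) - 1 + a (exp (- y) - 1) <= tau(t) for 0 <= y <= b t.
   With s = N E X^2, l = u / (4 s) <= sqrt 2 and r = (1 + u) / 2, this yields
     P(B >= M + 1 + u) <= 2^a exp (- l / 2) exp (- u^2 / (16 s))
   for a = 2 when l <= 1 and for a = 3 when l <= sqrt 2, while a = 1/2, with the
   roles of the two sets exchanged, yields
     P(B <= M - 1 - u) <= 4 exp (- l / 2) exp (- u^2 / (16 s)).
   The factors add up to 8 exp (- l / 2) if l <= 1, and otherwise to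
   12 exp (- l / 2) <= 12 exp (- 1 / 2) <= 8. *)

Require Import Defs.
From HB Require Import structures.
From mathcomp Require Import all_boot all_order all_algebra.
From mathcomp Require Import all_classical all_reals all_analysis.
From mathcomp Require Import measurable_realfun.
From mathcomp Require Import ring lra.

Set Implicit Arguments.
Unset Strict Implicit.
Unset Printing Implicit Defensive.

Import Order.TTheory GRing.Theory Num.Theory.
Import numFieldNormedType.Exports.

Local Open Scope classical_set_scope.
Local Open Scope ring_scope.

(** * Taylor bounds for the exponential *)

(* [p.[x] * expR (c * x)] is nondecreasing and equals 1 at the origin. *)
Lemma expR_le_horner (R : realType) (c b : R) (p : {poly R}) :
  (forall x, 0 < x < b -> 0 <= p^`().[x] + c * p.[x]) -> p.[0] = 1 ->
  forall x, 0 <= x <= b -> expR (- (c * x)) <= p.[x].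
Proof.
move=> p'p p0 x /andP[x0 xb].
pose f y := p.[y] * expR (c * y).
have df (y : R) : is_derive y (1 : R) f ((p^`().[y] + c * p.[y]) * expR (c * y)).
  apply: is_derive_eq.
  rewrite /GRing.scale /=; ring.
have : f 0 <= f x.
  apply: (@ger0_derive1_ndecr R f 0 b) => //.
  - move=> y; rewrite in_itv /= => yb.
    have dfy := df y; rewrite derive1E derive_val mulr_ge0 ?expR_ge0 //; exact: p'p.
  - by apply: derivable_within_continuous => y _; apply: (@ex_derive _ _ _ _ _ _ _ (df y)).
rewrite /f mulr0 expR0 p0 mulr1 => h.
by rewrite expRN -div1r ler_pdivrMr ?expR_gt0.
Qed.

(** The Taylor polynomial of the exponential, cut after [n] terms so that differentiation just
    lowers [n] by one. *)
Definition exp_poly (R : realType) (n : nat) : {poly R} := \poly_(i < n) i`!%:R^-1.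

Lemma deriv_exp_poly (R : realType) (n : nat) : (exp_poly R n.+1)^`() = exp_poly R n.
Proof.
apply/polyP => i; rewrite coef_deriv !coef_poly ltnS.
case: ifP => // _; last by rewrite mul0rn.
by rewrite -[LHS]mulr_natr factS natrM invfM mulrC mulrA mulfV ?mul1r // pnatr_eq0.
Qed.

Lemma horner_exp_polyS (R : realType) (n : nat) (x : R) :
  (exp_poly R n.+1).[x] = (exp_poly R n).[x] + x ^+ n / n`!%:R.
Proof. by rewrite !horner_poly big_ord_recr /= mulrC [_ / _]mulrC [X in _ + X]mulrC. Qed.

Lemma horner_exp_poly0 (R : realType) (n : nat) : (exp_poly R n.+1).[0] = 1.
Proof. by rewrite horner_coef0 coef_poly /= fact0 invr1. Qed.

(** The factor [c] on the last term pays for the rest of the series: if [p] is the right-hand side,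
    then [p' - p] is a nonnegative multiple of [(c - 1) * n.+1%:R - c * x], so the hypothesis on
    [c * x] gives its sign on the whole interval. *)
Lemma expR_le_taylor (R : realType) (n : nat) (c x : R) : 0 <= c -> 0 <= x ->
  c * x <= (c - 1) * n.+1%:R ->
  expR x <= (exp_poly R n.+1).[x] + c * (x ^+ n.+1 / n.+1`!%:R).
Proof.
move=> c0 x0 cx.
pose p := exp_poly R n.+1 + (c / n.+1`!%:R) *: 'X^(n.+1).
have fE : n.+1%:R / n.+1`!%:R = n`!%:R^-1 :> R.
  by rewrite factS natrM invfM mulrA mulfV ?mul1r // pnatr_eq0.
have pE y : p.[y] = (exp_poly R n.+1).[y] + c * (y ^+ n.+1 / n.+1`!%:R).
  by rewrite /p !hornerE /=; congr (_ + _); rewrite mulrAC.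
have pp' y : 0 < y < x -> 0 <= p^`().[y] + -1 * p.[y].
  move=> /andP[y0 yx].
  have -> : p^`().[y] + -1 * p.[y] = y ^+ n / n.+1`!%:R * ((c - 1) * n.+1%:R - c * y).
    rewrite pE /p !poly.derivE deriv_exp_poly horner_exp_polyS -fE !hornerE /= hornerMn !hornerE /=.
    rewrite exprS -mulr_natr; ring.
  apply: mulr_ge0; first by rewrite divr_ge0 ?ler0n ?exprn_ge0 // ltW.
  by rewrite subr_ge0 (le_trans _ cx) // ler_wpM2l // ltW.
have p0 : p.[0] = 1 by rewrite pE horner_exp_poly0 expr0n mul0r mulr0 addr0.
have := @expR_le_horner R _ _ _ pp' p0 x.
by rewrite x0 lexx mulN1r opprK pE; apply.
Qed.

(** With [p] the truncated series evaluated at [- x], the sum [p' + p] telescopes to the term of top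
    degree, whose exponent [n.*2] is even. *)
Lemma expRN_le_taylor (R : realType) (n : nat) (x : R) : 0 <= x ->
  expR (- x) <= (exp_poly R n.*2.+1).[- x].
Proof.
move=> x0; pose p := exp_poly R n.*2.+1 \Po (- 'X).
have pE y : p.[y] = (exp_poly R n.*2.+1).[- y].
  by rewrite /p horner_comp !hornerE.
have pp' y : 0 < y < x -> 0 <= p^`().[y] + 1 * p.[y].
  move=> /andP[y0 _]; rewrite mul1r pE /p deriv_comp deriv_exp_poly.
  rewrite !(hornerE, horner_comp) derivN derivX !hornerE /= horner_exp_polyS.
  rewrite mulrN1 addKr divr_ge0 ?ler0n //.
  by rewrite -mul2n exprM sqrrN exprn_ge0 // exprn_ge0 // ltW.
have p0 : p.[0] = 1 by rewrite pE oppr0 horner_exp_poly0.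
have := @expR_le_horner R _ _ _ pp' p0 x.
by rewrite x0 lexx mul1r pE; apply.
Qed.

Lemma expR_le_poly7 (R : realType) (x : R) : 0 <= x <= 7 / 4 ->
  expR x <= 1 + x + x ^+ 2 / 2 + x ^+ 3 / 6 + x ^+ 4 / 24 + x ^+ 5 / 120
            + x ^+ 6 / 720 + x ^+ 7 / 3780.
Proof.
move=> /andP[x0 x74].
(* The choice [c = 4 / 3] reaches exactly up to [x = 7 / 4], and [3780 = 5040 / c]. *)
have c0 : 0 <= 4 / 3 :> R by lra.
have cx : 4 / 3 * x <= (4 / 3 - 1) * 7 by lra.
apply: (le_trans (@expR_le_taylor R 6 _ _ c0 x0 cx)).
rewrite !horner_exp_polyS /exp_poly horner_poly big_ord0 fact0 (_ : 1`! = 1)%N // expr0 expr1.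
rewrite (_ : 7`! = 1260 * 4)%N // natrM.
rewrite (_ : 2`! = 2)%N // (_ : 3`! = 6)%N // (_ : 4`! = 24)%N //.
rewrite (_ : 5`! = 120)%N // (_ : 6`! = 720)%N //.
lra.
Qed.

Lemma expRN_le_poly4 (R : realType) (x : R) : 0 <= x ->
  expR (- x) <= 1 - x + x ^+ 2 / 2 - x ^+ 3 / 6 + x ^+ 4 / 24.
Proof.
move=> x0; apply: (le_trans (@expRN_le_taylor R 2 x x0)).
rewrite /= !horner_exp_polyS /exp_poly horner_poly big_ord0 fact0 (_ : 1`! = 1)%N // expr0 expr1.
rewrite (_ : 2`! = 2)%N // (_ : 3`! = 6)%N // (_ : 4`! = 24)%N //; lra.
Qed.

(** * Quadratic bounds on the tilt *)

(** The value of [psi - 1 + a * (v - 1)] at [psi = expR (a * y)] and [v = expR (- y)], a curve on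
    which [psi] times the [a]-th power of [v] is 1. *)
Definition tilt (R : realType) (a y : R) : R := expR (a * y) - 1 + a * (expR (- y) - 1).

(** The terms of degree one cancel between the two Taylor bounds. [H] bounds every power from the
    third on by a multiple of the preceding one, and what remains is linear in the powers of [y]. *)
Lemma tilt2_le (R : realType) (y : R) : 0 <= y -> 2 * y <= 1 -> tilt 2 y <= (2 * y) ^+ 2.
Proof.
move=> y0 y1; have z0 : 0 <= 2 * y by lra.
rewrite /tilt; move: (@expR_le_poly7 R (2 * y)) (expRN_le_poly4 y0).
rewrite z0 /=; have -> : 2 * y <= 7 / 4 by lra.
move=> /(_ isT).
have H k : y ^+ k.+3 <= 2^-1 * y ^+ k.+2.
  by rewrite [y ^+ k.+3]exprS ler_wpM2r ?exprn_ge0 //; lra.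
have z2 : 0 <= y ^+ 2 by rewrite exprn_ge0.
move: (H 0%N) (H 1%N) (H 2%N) (H 3%N) (H 4%N).
rewrite !exprMn => h1 h2 h3 h4 h5; lra.
Qed.

Lemma tilt3_le (R : realType) (y : R) :
  0 <= y -> (3 * y) ^+ 2 <= 2 -> tilt 3 y <= (3 * y) ^+ 2.
Proof.
move=> y0 y2; set z := 3 * y; have z0 : 0 <= z by rewrite /z; lra.
(* A rational just above the square root of 2. *)
have z1 : z <= 17 / 12.
  by rewrite -(@ler_pXn2r _ 2) ?nnegrE // (le_trans y2) //; lra.
rewrite /tilt -/z; move: (@expR_le_poly7 R z) (expRN_le_poly4 y0).
rewrite z0 /=; have -> : z <= 7 / 4 by lra.
move=> /(_ isT).
have -> : y = z / 3 by rewrite /z; lra.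
clearbody z => {y0 y2 y}.
have H k : z ^+ k.+3 <= 17 / 12 * z ^+ k.+2.
  by rewrite [z ^+ k.+3]exprS ler_wpM2r ?exprn_ge0.
have z2 : 0 <= z ^+ 2 by rewrite exprn_ge0.
move: (H 0%N) (H 1%N) (H 2%N) (H 3%N) (H 4%N).
rewrite !exprMn => h1 h2 h3 h4 h5; lra.
Qed.

Lemma tilt_half_le (R : realType) (y : R) :
  0 <= y -> y ^+ 2 <= 2 -> tilt 2^-1 y <= 2^-1 * y ^+ 2.
Proof.
move=> y0 y2; set z := 2^-1 * y; have z0 : 0 <= z by rewrite /z; lra.
(* Here a coarser upper bound for the square root of 2 is enough. *)
have y1 : y <= 3 / 2.
  by rewrite -(@ler_pXn2r _ 2) ?nnegrE // ?(le_trans y2) //; lra.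
have z1 : z <= 3 / 4 by rewrite /z; lra.
rewrite /tilt -/z; move: (@expR_le_poly7 R z) (expRN_le_poly4 y0).
rewrite z0 /=; have -> : z <= 7 / 4 by lra.
move=> /(_ isT).
have -> : y = 2 * z by rewrite /z; lra.
clearbody z => {y0 y1 y2 y}.
have H k : z ^+ k.+3 <= 3 / 4 * z ^+ k.+2.
  by rewrite [z ^+ k.+3]exprS ler_wpM2r ?exprn_ge0.
have z2 : 0 <= z ^+ 2 by rewrite exprn_ge0.
have z3 : 0 <= z ^+ 3 by rewrite exprn_ge0.
move: (H 0%N) (H 1%N) (H 2%N) (H 3%N) (H 4%N).
rewrite !exprMn => h1 h2 h3 h4 h5; lra.
Qed.

(** * Deterministic packing estimates *)

Lemma packableP (R : realType) (N : nat) (x : 'I_N -> R) (k : nat) :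
  reflect (exists f : 'I_N -> 'I_k, forall j, \sum_(i < N | f i == j) x i <= 1)
          (packable x k).
Proof.
apply: (iffP existsP) => [[f /forallP h]|[f h]]; first by exists f.
exists [ffun i => f i]; apply/forallP => j.
by under eq_bigl do rewrite ffunE.
Qed.

Lemma packable_leq (R : realType) (N : nat) (x : 'I_N -> R) (k l : nat) :
  (k <= l)%N -> packable x k -> packable x l.
Proof.
move=> kl /packableP[f hf]; apply/packableP; exists (fun i => widen_ord kl (f i)) => j.
have [jk|kj] := ltnP j k.
  by apply: le_trans (hf (Ordinal jk)).
rewrite big_pred0 ?ler01 // => i; apply/negbTE; apply: contraTneq kj => <-.
by rewrite -ltnNge /= ltn_ord.
Qed.

(** Bin [j] is emptied into [j']: [unlift j] renumbers the bins other than [j], and [t] is the new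
    index of [j']. *)
Lemma packable_merge (R : realType) (N k : nat) (x : 'I_N -> R)
    (f : 'I_N -> 'I_k.+1) (j j' : 'I_k.+1) :
  (forall i, \sum_(a < N | f a == i) x a <= 1) -> j != j' ->
  \sum_(i < N | f i == j) x i + \sum_(i < N | f i == j') x i <= 1 ->
  packable x k.
Proof.
move=> hf jj' hjj'; have [t jt _] := unlift_some jj'.
apply/packableP.
exists (fun i => if unlift j (f i) is Some b then b else t) => b.
have [->|bt] := eqVneq b t.
  apply: le_trans hjj'; rewrite le_eqVlt; apply/orP; left; apply/eqP.
  rewrite (bigID (fun i => f i == j)) /=; congr (_ + _); apply: eq_bigl => i.
    by case: (eqVneq (f i) j) => [->|]; rewrite ?unlift_none ?eqxx ?andbF.
  case: unliftP => [c ->|->]; rewrite ?eqxx ?andbF.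
    by rewrite [lift j c == j]eq_sym (negbTE (neq_lift _ _)) jt (inj_eq lift_inj) andbT.
  by rewrite (negbTE jj').
apply: le_trans (hf (lift j b)); rewrite le_eqVlt; apply/orP; left; apply/eqP.
apply: eq_bigl => i; case: unliftP => [c ->|->].
  by rewrite (inj_eq lift_inj).
by rewrite eq_sym (negbTE bt) (negbTE (neq_lift _ _)).
Qed.

(* In a packing with the least number of bins, any two bins have total content
   more than 1, in particular any two cyclically consecutive ones. *)
Lemma not_packable_sum_ge (R : realType) (N m : nat) (x : 'I_N -> R) :
  (forall i, 0 <= x i <= 1) -> (0 < m)%N -> ~~ packable x m ->
  m.+1%:R <= 2 * \sum_(i < N) x i.
Proof.
move=> x01 m0 xm; have [] := bin_packing_numberP x01.
move: (bin_packing_number x) => k kp kmin.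
have mk : (m < k)%N by rewrite ltnNge; apply: contra xm => /packable_leq; apply.
case: k => [//|k] in kp kmin mk *.
have /packableP[f hf] := kp.
pose c j := \sum_(i < N | f i == j) x i.
have c1 j j' : j != j' -> 1 <= c j + c j'.
  move=> jj'; rewrite leNgt; apply/negP => /ltW h.
  by have /kmin := packable_merge hf jj' h; rewrite ltnn.
have -> : \sum_(i < N) x i = \sum_j c j by rewrite (partition_big f xpredT).
rewrite mulr2n mulrDl mul1r {2}(reindex_inj (@ordS_inj k.+1)) -big_split /=.
apply: le_trans (_ : \sum_(j < k.+1) 1 <= _).
  by rewrite sumr_const card_ord ler_nat.
apply: ler_sum => j _; apply: c1; rewrite -val_eqE /=.
(* There are at least two bins, so a bin differs from its cyclic successor even when the last one
   wraps around to 0. *)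
have k0 : (0 < k)%N by rewrite (leq_trans m0).
have := ltn_ord j; rewrite ltnS leq_eqVlt => /predU1P[->|jk].
  by rewrite modnn gtn_eqF.
by rewrite modn_small // ltn_eqF.
Qed.

(** Only the sizes in [x] count, since these are the items to be repacked; the quantity is not
    symmetric. *)
Definition differing_sizes (R : realType) (N : nat) (x y : 'I_N -> R) : R :=
  \sum_(i < N | x i != y i) x i.

(** Items with [x i = y i] keep their bin in the packing of [y], the others go to [m] fresh bins.
    Giving the unmoved items size 0 keeps all [N] indices in the second packing. *)
Lemma packable_union (R : realType) (N l m : nat) (x y : 'I_N -> R) :
  (forall i, 0 <= y i) -> packable y l ->
  packable (fun i => if x i != y i then x i else 0) m -> packable x (l + m).
Proof.
move=> y0 /packableP[f hf] /packableP[g hg]; apply/packableP.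
exists (fun i => if x i != y i then rshift l (g i) else lshift m (f i)) => j.
case: (split_ordP j) => {}j ->.
  apply: le_trans (hf j); rewrite big_mkcond [leRHS]big_mkcond /=.
  apply: ler_sum => i _; case: (boolP (x i != y i)) => xy; last first.
    by rewrite (inj_eq (@lshift_inj _ _)); move: xy; rewrite negbK => /eqP ->.
  by rewrite eq_rlshift; case: ifP.
apply: le_trans (hg j); rewrite big_mkcond [leRHS]big_mkcond /=.
apply: ler_sum => i _; case: (boolP (x i != y i)) => xy.
  by rewrite (inj_eq (@rshift_inj _ _)).
by rewrite eq_lrshift if_same.
Qed.

Lemma bin_packing_number_sub_le (R : realType) (N : nat) (x y : 'I_N -> R) :
  (forall i, 0 <= x i <= 1) -> (forall i, 0 <= y i <= 1) ->
  ((bin_packing_number y).+1 < bin_packing_number x)%N ->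
  (bin_packing_number x)%:R - (bin_packing_number y)%:R <= 2 * differing_sizes x y.
Proof.
move=> x01 y01.
have [_ xmin] := bin_packing_numberP x01; have [yp _] := bin_packing_numberP y01.
move: (bin_packing_number x) (bin_packing_number y) xmin yp => b a xmin yp ab.
have /not_packable_sum_ge h : forall i, 0 <= (if x i != y i then x i else 0) <= 1.
  by move=> i; case: ifP; rewrite ?lexx ?ler01.
(* The differing items do not fit into [b - a.+1] bins, since [packable_union] would then pack [x]
   into [b - 1]. The gap of at least 2 makes [b - a.+1] positive, as [not_packable_sum_ge]
   requires. *)
have := h (b - a.+1)%N; rewrite subn_gt0 ab -big_mkcond /= => /(_ isT).
have ab' := ltnW ab; rewrite subnSK // natrB ?(ltnW ab') //.
apply; apply/negP => zp.
have /xmin : packable x (a + (b - a.+1)).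
  by apply: packable_union zp => // i; case/andP: (y01 i).
by rewrite leqNgt -ltnS -addSn subnKC // ltnSn.
Qed.

(** * Independence of the first coordinate and the remaining ones *)

Lemma mutually_independent_tail d (T : measurableType d) (R : realType)
    (P : probability T R) (n : nat) (X : 'I_n.+1 -> {RV P >-> R}) :
  mutually_independent X ->
  @mutually_independent d T R P 'I_n (fun i => X (lift ord0 i)).
Proof.
move=> indX J A mA.
pose B j := if unlift ord0 j is Some i then A i else setT.
have mB j : measurable (B j) by rewrite /B; case: unliftP.
have := indX (lift ord0 @: J)%SET B mB.
rewrite big_imset /=; last by move=> i j _ _; exact: lift_inj.
rewrite (eq_bigr (fun i => P (X (lift ord0 i) @^-1` A i))); last first.
  by move=> i _; rewrite /B liftK.
move=> <-; congr (P _); apply/seteqP; split => w /= h.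
  by move=> j /= /imsetP[i iJ ->]; rewrite /B liftK; exact: h.
move=> i iJ; have := h (lift ord0 i); rewrite /B liftK; apply.
by rewrite /=; apply/imsetP; exists i.
Qed.

Definition sample d (T : measurableType d) (R : realType) (n : nat)
    (X : 'I_n -> {mfun T >-> R}) (w : T) : n.-tuple R := [tuple X i w | i < n].

Lemma measurable_sample d (T : measurableType d) (R : realType) (n : nat)
    (X : 'I_n -> {mfun T >-> R}) : measurable_fun setT (sample X).
Proof.
apply/measurable_fun_tnthP => i.
rewrite (_ : _ \o _ = X i); first exact: measurable_funPT.
by apply/funext => w /=; rewrite tnth_mktuple.
Qed.

HB.instance Definition _ d (T : measurableType d) (R : realType) (n : nat)
    (X : 'I_n -> {mfun T >-> R}) :=
  isMeasurableFun.Build _ _ _ _ (sample X) (measurable_sample X).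

Definition box (R : realType) (n : nat) (C : 'I_n -> set R) : set (n.-tuple R) :=
  [set t | forall i, C i (tnth t i)].

(** Cylinders generate this sigma-algebra by definition; boxes are moreover stable under
    intersection, which uniqueness of measures requires. *)
Lemma measurable_tuple_box (R : realType) (n : nat) :
  @measurable _ (n.-tuple R) =
  <<s [set B | exists2 C : 'I_n -> set R, (forall i, measurable (C i)) & B = box C] >>.
Proof.
apply/seteqP; split.
  apply: smallest_sub; first exact: smallest_sigma_algebra.
  rewrite -bigcup_seq => A [i _ [C mC <-]]; apply: sub_sigma_algebra.
  exists (fun j => if j == i then C else setT); first by move=> j; case: ifP.
  rewrite setTI; apply/seteqP; split => t /= h.
    by move=> j; case: eqP => // ->.
  by have := h i; rewrite eqxx.
apply: smallest_sub; first exact: sigma_algebra_measurable.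
move=> _ [C mC ->].
rewrite (_ : box C = \big[setI/setT]_(i < n) ((@tnth n R ^~ i) @^-1` C i)).
  apply: bigsetI_measurable => i _; rewrite -[X in measurable X]setTI.
  exact: measurable_tnth.
apply/seteqP; split => t; rewrite -bigcap_seq /= => h i.
  by move=> _; exact: h.
by apply: h; rewrite /= mem_index_enum.
Qed.

(** For fixed [A], both sides are finite measures in [B]: the restriction of [P] pushed forward by
    the tail, and a scaled pushforward of [P]. They agree on boxes by mutual independence, hence on
    all measurable sets. *)
Lemma head_tail_independent d (T : measurableType d) (R : realType)
    (P : probability T R) (n : nat) (X : 'I_n.+1 -> {RV P >-> R})
    (A : set R) (B : set (n.-tuple R)) :
  mutually_independent X -> measurable A -> measurable B ->
  P (X ord0 @^-1` A `&` sample (fun i => X (lift ord0 i)) @^-1` B) =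
  (P (X ord0 @^-1` A) * P (sample (fun i => X (lift ord0 i)) @^-1` B))%E.
Proof.
move=> indX mA; set V := sample _.
have mV : measurable_fun setT V by exact: measurable_sample.
have mXA : measurable (X ord0 @^-1` A).
  by rewrite -[X in measurable X]setTI; exact: measurable_funPT.
have PA : P (X ord0 @^-1` A) \is a fin_num by exact: fin_num_measure.
pose r : {nonneg R} := NngNum (fine_ge0 (measure_ge0 P (X ord0 @^-1` A))).
pose m1 : {measure set (n.-tuple R) -> \bar R} :=
  pushforward (mrestr P mXA) V.
pose m2 : {measure set (n.-tuple R) -> \bar R} :=
  mscale r (pushforward P V).
suff : forall B, measurable B -> m1 mV B = m2 mV B.
  move=> /(_ B) + mB => /(_ mB); rewrite /m1 /m2 /= /pushforward /mrestr /mscale /=.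
  by rewrite fineK // setIC.
apply: (measure_unique _ (fun=> setT) (measurable_tuple_box R n)).
- move=> _ _ [C mC ->] [D mD ->]; exists (fun i => C i `&` D i).
    by move=> i; exact: measurableI.
  by apply/seteqP; split => t /=; [move=> [hC hD] i; split|move=> h; split=> i; have [] := h i].
- by move=> _; exists (fun=> setT) => //; apply/seteqP; split.
- by apply/seteqP; split => // t _; exists 0%N.
- move=> _ [C mC ->].
  rewrite /m1 /m2 /= /pushforward /mrestr /mscale /= fineK //.
  have tail : P (V @^-1` box C) = (\prod_(i < n) P (X (lift ord0 i) @^-1` C i))%E.
    have := mutually_independent_tail indX [set: 'I_n]%SET mC.
    rewrite [RHS](eq_bigl xpredT); last by move=> i; rewrite inE.
    move=> <-; congr (P _); apply/seteqP; split => w /= h i.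
      by move=> _; have := h i; rewrite tnth_mktuple.
    by rewrite tnth_mktuple; apply: h => /=; rewrite inE.
  transitivity (P (X ord0 @^-1` A) * P (V @^-1` box C))%E; last by [].
  rewrite tail.
  pose D j := if unlift ord0 j is Some i then C i else A.
  have mD j : measurable (D j) by rewrite /D; case: unliftP.
  have := indX [set: 'I_n.+1]%SET D mD.
  rewrite [RHS](eq_bigl xpredT); last by move=> i; rewrite inE.
  rewrite big_ord_recl /D unlift_none.
  under eq_bigr do rewrite liftK.
  move=> <-; congr (P _); apply/seteqP; split => w /=.
    move=> [h0 hA] j _ /=; case: unliftP => [i ->|-> //].
    by have := h0 i; rewrite tnth_mktuple.
  move=> h; split; last by have := h ord0; rewrite /= inE unlift_none; apply.
  by move=> i; rewrite tnth_mktuple; have := h (lift ord0 i); rewrite /= inE liftK; apply.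
- move=> _; rewrite /m1 /= /pushforward /mrestr /= preimage_setT setTI.
  by apply: (@le_lt_trans _ _ 1%E); [exact: probability_le1|exact: ltry].
Qed.

(* The joint law of two independent random elements is the product of their
   laws, so this is Tonelli's theorem. *)
Lemma independent_integral d d1 d2 (T : measurableType d) (T1 : measurableType d1)
    (T2 : measurableType d2) (R : realType) (P : probability T R)
    (U : {mfun T >-> T1}) (V : {mfun T >-> T2}) (f : T1 * T2 -> \bar R) :
  (forall A B, measurable A -> measurable B ->
    P (U @^-1` A `&` V @^-1` B) = (P (U @^-1` A) * P (V @^-1` B))%E) ->
  measurable_fun [set: T1 * T2] f -> (forall p, 0 <= f p)%E ->
  (\int[P]_w f (U w, V w) = \int[P]_w \int[P]_w' f (U w, V w'))%E.
Proof.
move=> indUV mf f0.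
have mW : measurable_fun setT (fun w => (U w, V w)).
  by apply/measurable_fun_pair; exact: measurable_funPT.
pose W : {mfun T >-> (T1 * T2)%type} := HB.pack (fun w => (U w, V w))
  (isMeasurableFun.Build _ _ _ _ _ mW).
rewrite -(ge0_integral_distribution W) //.
transitivity (\int[distribution P U \x distribution P V]_p f p)%E.
  apply: eq_measure_integral => A mA _; apply/esym.
  exact: product_measure_unique.
rewrite fubini_tonelli1 // ge0_integral_distribution; last 2 first.
- exact: measurable_fun_fubini_tonelli_F.
- by move=> y; exact: integral_ge0.
apply: eq_integral => w _ /=; rewrite /fubini_F ge0_integral_distribution //.
by apply: measurableT_comp => //; exact: pair1_measurable.
Qed.

(** * The inequality in one variable *)

Lemma bounded_integrable d (T : measurableType d) (R : realType)
    (P : probability T R) (f : T -> R) (K : R) :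
  measurable_fun setT f -> (forall w, 0 <= f w <= K) ->
  P.-integrable setT (EFin \o f).
Proof.
move=> mf fK; apply: measurable_bounded_integrable => //.
  exact: le_lt_trans (probability_le1 P measurableT) (ltry _).
exists K; split; first exact: num_real.
move=> M KM w _; have /andP[f0 fM] := fK w.
by rewrite /= ger0_norm // (le_trans fM) // ltW.
Qed.

Lemma Rintegral_probability_cst d (T : measurableType d) (R : realType)
  (P : probability T R) (c : R) : \int[P]_(_ in setT) c = c.
Proof.
rewrite Rintegral_cst // (_ : fine _ = 1) ?mulr1 //.
exact: (congr1 fine (probability_setT P)).
Qed.

(* With [h = sup eta], the functions [psi = phi * h `^ a / D] and [v = eta / h]
   satisfy [psi - 1 + a * (v - 1) <= tau] pointwise: take [y = - ln v], truncated
   at [b]. Then integrate and use [x <= expR (x - 1)] twice. *)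
Lemma one_point_inequality d (T : measurableType d) (R : realType)
    (P : probability T R) (a D K : R) (b tau phi eta : T -> R) :
  0 < a -> 0 < D -> (forall w, 0 <= b w) ->
  (forall w y, 0 <= y <= b w -> tilt a y <= tau w) ->
  P.-integrable setT (EFin \o tau) ->
  measurable_fun setT phi -> measurable_fun setT eta ->
  (forall w, 0 <= phi w <= K) -> (forall w, 0 <= eta w <= K) ->
  (forall w, phi w * eta w `^ a <= D) ->
  (forall w w', phi w * eta w' `^ a <= D * expR (a * b w)) ->
  (\int[P]_w phi w) * (\int[P]_w eta w) `^ a <= D * expR (\int[P]_w tau w).
Proof.
move=> a0 D0 b0 tilt_tau itau mphi meta phiK etaK diag offdiag.
have phi0 w : 0 <= phi w by case/andP: (phiK w).
have eta0 w : 0 <= eta w by case/andP: (etaK w).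
(* The supremum [h] will be a divisor, so a vanishing [eta] is treated apart. *)
have [etaZ|] := pselect (forall w, eta w = 0).
  rewrite (_ : eta = fun=> 0); last by apply/funext.
  by rewrite Rintegral_probability_cst powR0 ?gt_eqF // mulr0 mulr_ge0 ?expR_ge0 // ltW.
move=> /existsNP[w0 /eqP etaw0].
have etaw0' : 0 < eta w0 by rewrite lt_def etaw0 eta0.
pose h := sup (range eta).
have hsup : has_sup (range eta).
  split; first by exists (eta w0), w0.
  by exists K => _ [w _ <-]; case/andP: (etaK w).
have eta_h w : eta w <= h by apply: ub_le_sup; [case: hsup|exists w].
have h0 : 0 < h by apply: lt_le_trans (eta_h w0).
(* [offdiag] holds for every [w']: solved for [eta w'] it bounds the supremum [h], and raising to
   the power [a] again gives the claim. *)
have phih w : phi w * h `^ a <= D * expR (a * b w).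
  have [->|phi1] := eqVneq (phi w) 0; first by rewrite mul0r mulr_ge0 ?expR_ge0 ?ltW.
  have {}phi1 : 0 < phi w by rewrite lt_def phi1 phi0.
  set C := D * _; have C0 : 0 < C by rewrite mulr_gt0 ?expR_gt0.
  rewrite -ler_pdivlMl // mulrC.
  have q0 : 0 < C / phi w by rewrite divr_gt0.
  have : h <= (C / phi w) `^ a^-1.
    apply: ge_sup; first by case: hsup.
    move=> _ [w' _ <-].
    have := offdiag w w'; rewrite -/C -ler_pdivlMl // mulrC => etaw'.
    have := @ge0_ler_powR _ a^-1 _ _ _ _ _ etaw'.
    rewrite -powRrM mulfV ?gt_eqF // powRr1 //; apply.
    - by rewrite invr_ge0 ltW.
    - by rewrite nnegrE powR_ge0.
    - by rewrite nnegrE ltW.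
  move=> hq; have := @ge0_ler_powR _ a _ _ _ _ _ hq.
  rewrite -powRrM mulVf ?gt_eqF // powRr1 ?(ltW q0) //; apply.
  - exact: ltW.
  - by rewrite nnegrE ltW.
  - by rewrite nnegrE powR_ge0.
pose psi (w : T) : R := (h `^ a / D) * phi w.
pose v (w : T) : R := h^-1 * eta w.
have hD : 0 < h `^ a / D by rewrite divr_gt0 ?powR_gt0.
have v0 w : 0 <= v w by rewrite mulr_ge0 // invr_ge0 ltW.
have psi0 w : 0 <= psi w by rewrite mulr_ge0 // ltW.
have v1 w : v w <= 1 by rewrite /v mulrC ler_pdivrMr // mul1r.
have psib w : psi w <= expR (a * b w).
  rewrite /psi mulrAC ler_pdivrMr // mulrC [leRHS]mulrC; exact: phih.
have psiv w : psi w * v w `^ a <= 1.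
  have ha : h `^ a != 0 by rewrite gt_eqF ?powR_gt0.
  have hV : h^-1 `^ a = (h `^ a)^-1.
    apply: (mulIf ha); rewrite -powRM ?invr_ge0 ?(ltW h0) // !mulVf ?gt_eqF ?powR_gt0 //.
    by rewrite powR1.
  rewrite /psi /v powRM ?invr_ge0 ?(ltW h0) // hV.
  rewrite (_ : _ * _ = phi w * eta w `^ a / D); last first.
    by field; rewrite ha (gt_eqF D0).
  by rewrite ler_pdivrMr // mul1r.
have pointwise w : psi w - 1 + a * (v w - 1) <= tau w.
  have [vb|bv] := leP (expR (- b w)) (v w).
    have vgt0 : 0 < v w by apply: lt_le_trans vb; exact: expR_gt0.
    have vE : v w = expR (- - ln (v w)) by rewrite opprK lnK // posrE.
    have := tilt_tau w (- ln (v w)); rewrite /tilt -vE.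
    have -> : 0 <= - ln (v w) <= b w.
      rewrite oppr_ge0 ln_le0 // lerNl -[- b w]expRK ler_ln ?posrE ?expR_gt0 //.
    move=> /(_ isT); apply: le_trans; rewrite lerD2r lerD2r.
    rewrite mulrN expRN -div1r ler_pdivlMr ?expR_gt0 //.
    by rewrite mulrC -ln_powR lnK ?posrE ?powR_gt0 // mulrC.
  (* In the truncated case [y = b w], [psib] bounds [psi w] and the case assumption bounds [v w]. *)
  have := tilt_tau w (b w); rewrite lexx b0 => /(_ isT); apply: le_trans.
  rewrite /tilt lerD // ?lerD2r // ler_pM2l // lerD2r; exact: ltW.
have mpsi : measurable_fun setT psi by exact: measurable_funM.
have mv : measurable_fun setT v by exact: measurable_funM.
have iphi := bounded_integrable P mphi phiK.
have ieta := bounded_integrable P meta etaK.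
have ipsi : P.-integrable setT (EFin \o psi).
  apply: (@bounded_integrable _ _ _ _ _ ((h `^ a / D) * K)) => // w.
  by rewrite psi0 /= ler_pM2l //; case/andP: (phiK w).
have iv : P.-integrable setT (EFin \o v).
  by apply: (@bounded_integrable _ _ _ _ _ 1) => // w; rewrite v0 v1.
have icst (c : R) : P.-integrable setT (EFin \o (fun=> c)).
  exact: finite_measure_integrable_cst.
have ipsi1 : P.-integrable setT (EFin \o (fun w => psi w - 1)).
  exact: (integrableB measurableT ipsi (icst 1)).
have iv1 : P.-integrable setT (EFin \o (fun w => v w - 1)).
  exact: (integrableB measurableT iv (icst 1)).
have iav1 : P.-integrable setT (EFin \o (fun w => a * (v w - 1))).
  exact: (integrableZl measurableT a iv1).
have total : \int[P]_w psi w - 1 + a * (\int[P]_w v w - 1) <= \int[P]_w tau w.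
  have <- : \int[P]_w (psi w - 1 + a * (v w - 1)) =
      \int[P]_w psi w - 1 + a * (\int[P]_w v w - 1).
    rewrite RintegralD // RintegralB // Rintegral_probability_cst RintegralZl //.
    by rewrite RintegralB // Rintegral_probability_cst.
  apply: le_Rintegral => //.
  exact: (integrableD measurableT ipsi1 iav1).
have psiE : \int[P]_w phi w = D / h `^ a * \int[P]_w psi w.
  rewrite /psi RintegralZl // mulrA; field.
  by rewrite (gt_eqF D0) gt_eqF ?powR_gt0.
have vE : \int[P]_w eta w = h * \int[P]_w v w.
  by rewrite /v RintegralZl // mulVKf ?gt_eqF.
have iv0 : 0 <= \int[P]_w v w by apply: Rintegral_ge0.
have ipsi0 : 0 <= \int[P]_w psi w by apply: Rintegral_ge0.
have -> : (\int[P]_w phi w) * (\int[P]_w eta w) `^ a =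
    D * (\int[P]_w psi w * (\int[P]_w v w) `^ a).
  rewrite psiE vE powRM ?(ltW h0) //; field.
  by rewrite gt_eqF ?powR_gt0.
rewrite ler_pM2l //; apply: le_trans (_ : expR (\int[P]_w psi w - 1) *
    expR (a * (\int[P]_w v w - 1)) <= _); last by rewrite -expRD ler_expR.
have le_expR1 (x : R) : x <= expR (x - 1).
  by have := expR_ge1Dx (x - 1); rewrite addrC subrK.
apply: ler_pM => //; first exact: powR_ge0.
rewrite mulrC expRM; apply: ge0_ler_powR => //; first exact: ltW.
by rewrite nnegrE expR_ge0.
Qed.

(** * Induction on the coordinates *)

(* [F] and [H] generalize the indicators of [S] and [A]; unlike the distance to
   the section of a set, their partial integrals are measurable. *)
Definition two_function_bound d (T : measurableType d) (R : realType)
    (P : probability T R) d' (S : measurableType d') (V : {mfun T >-> S})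
    (dist : S -> S -> R) (a C : R) : Prop :=
  forall (F H : S -> R) (K : R),
    measurable_fun setT F -> measurable_fun setT H ->
    (forall x, 0 <= F x <= K) -> (forall x, 0 <= H x <= K) ->
    (forall x y, F x * H y `^ a <= expR (a * dist x y)) ->
    (\int[P]_w F (V w)) * (\int[P]_w H (V w)) `^ a <= expR C.

Lemma Rintegral_probability_ge0_le d (T : measurableType d) (R : realType)
    (P : probability T R) (f : T -> R) (K : R) :
  measurable_fun setT f -> (forall w, 0 <= f w <= K) -> 0 <= \int[P]_w f w <= K.
Proof.
move=> mf fK; apply/andP; split.
  by apply: Rintegral_ge0 => w _; case/andP: (fK w).
rewrite -[leRHS](Rintegral_probability_cst P K); apply: le_Rintegral => //.
- exact: (bounded_integrable P mf fK).
- exact: finite_measure_integrable_cst.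
- by move=> w _; case/andP: (fK w).
Qed.

Lemma measurable_fun_partial_Rintegral d d1 d2 (T : measurableType d)
    (T1 : measurableType d1) (T2 : measurableType d2) (R : realType)
    (P : probability T R) (V : {mfun T >-> T2}) (F : T1 * T2 -> R) :
  measurable_fun setT F -> (forall p, 0 <= F p) ->
  measurable_fun setT (fun s => \int[P]_w F (s, V w)).
Proof.
move=> mF F0; apply: (measurableT_comp (fine_measurable measurableT)).
apply: (measurable_fun_fubini_tonelli_F (m2 := P) (fun p : T1 * T => (F (p.1, V p.2))%:E)).
  apply/measurable_EFinP; apply: (measurableT_comp mF).
  by apply/measurable_fun_pair => //=; apply: measurableT_comp => //; exact: measurable_snd.
by move=> p; rewrite lee_fin.
Qed.

Lemma independent_Rintegral d d1 d2 (T : measurableType d) (T1 : measurableType d1)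
    (T2 : measurableType d2) (R : realType) (P : probability T R)
    (U : {mfun T >-> T1}) (V : {mfun T >-> T2}) (F : T1 * T2 -> R) (K : R) :
  (forall A B, measurable A -> measurable B ->
    P (U @^-1` A `&` V @^-1` B) = (P (U @^-1` A) * P (V @^-1` B))%E) ->
  measurable_fun setT F -> (forall p, 0 <= F p <= K) ->
  \int[P]_w F (U w, V w) = \int[P]_w \int[P]_w' F (U w, V w').
Proof.
move=> indUV mF FK; rewrite /Rintegral.
rewrite (independent_integral (f := fun p => (F p)%:E) indUV); last 2 first.
- exact/measurable_EFinP.
- by move=> p; rewrite lee_fin; case/andP: (FK p).
congr fine; apply: eq_integral => w _; rewrite fineK //.
apply: integrable_fin_num => //.
apply: (@bounded_integrable _ _ _ P (fun w' => F (U w, V w')) K) => //.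
apply: (measurableT_comp mF); apply/measurable_fun_pair; first exact: measurable_cst.
exact: measurable_funPT.
Qed.

(** Integrating out the second coordinate leaves [phi] and [eta], to which the one-point inequality
    applies with [D = expR C]. Its diagonal and off-diagonal hypotheses come from [boundV] on
    sections: equal first coordinates cost nothing, others cost at most [b]. *)
Lemma two_function_bound_prod d d1 d2 (T : measurableType d) (R : realType)
    (P : probability T R) (T1 : measurableType d1) (T2 : measurableType d2)
    (U : {mfun T >-> T1}) (V : {mfun T >-> T2}) (W : {mfun T >-> (T1 * T2)%type})
    (a C : R) (b tau : T1 -> R) (dist : T2 -> T2 -> R) :
  0 < a -> (forall s, 0 <= b s) ->
  (forall s y, 0 <= y <= b s -> tilt a y <= tau s) ->
  P.-integrable setT (EFin \o (tau \o U)) ->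
  (forall A B, measurable A -> measurable B ->
    P (U @^-1` A `&` V @^-1` B) = (P (U @^-1` A) * P (V @^-1` B))%E) ->
  (forall w, W w = (U w, V w)) ->
  two_function_bound P V dist a C ->
  two_function_bound P W
    (fun p q => (if p.1 == q.1 :> T1 then 0 else b p.1) + dist p.2 q.2) a
    (\int[P]_w tau (U w) + C).
Proof.
move=> a0 b0 tilt_tau itau indUV WE boundV F H K mF mH FK HK FH.
have F0 p : 0 <= F p by case/andP: (FK p).
have H0 p : 0 <= H p by case/andP: (HK p).
pose phi s := \int[P]_w F (s, V w).
pose eta s := \int[P]_w H (s, V w).
have msec (G : T1 * T2 -> R) s : measurable_fun setT G ->
    measurable_fun setT (fun w => G (s, V w)).
  move=> mG; apply: (measurableT_comp mG); apply/measurable_fun_pair.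
    exact: measurable_cst.
  exact: measurable_funPT.
have mphi : measurable_fun setT (phi \o U).
  by apply: measurableT_comp; [exact: measurable_fun_partial_Rintegral|exact: measurable_funPT].
have meta : measurable_fun setT (eta \o U).
  by apply: measurableT_comp; [exact: measurable_fun_partial_Rintegral|exact: measurable_funPT].
have phiK s : 0 <= phi s <= K by apply: Rintegral_probability_ge0_le => //; exact: msec.
have etaK s : 0 <= eta s <= K by apply: Rintegral_probability_ge0_le => //; exact: msec.
have -> : \int[P]_w F (W w) = \int[P]_w phi (U w).
  rewrite -(independent_Rintegral indUV mF FK).
  by apply: eq_Rintegral => w _; rewrite WE.
have -> : \int[P]_w H (W w) = \int[P]_w eta (U w).
  rewrite -(independent_Rintegral indUV mH HK).
  by apply: eq_Rintegral => w _; rewrite WE.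
(* The factor [expR (- (a * c))] is absorbed into the section of [F], so that [boundV] only sees
   [dist]. *)
have section_bound s t c : 0 <= c ->
    (forall x y, F (s, x) * H (t, y) `^ a <= expR (a * (c + dist x y))) ->
    phi s * eta t `^ a <= expR C * expR (a * c).
  move=> c0 FHc; rewrite -ler_pdivrMr ?expR_gt0 // -expRN.
  have e1 : expR (- (a * c)) <= 1 by rewrite expR_le1 oppr_le0 mulr_ge0 // ltW.
  have mF' : measurable_fun setT (fun x => expR (- (a * c)) * F (s, x)).
    apply: measurable_funM; first exact: measurable_cst.
    by apply: (measurableT_comp mF); exact: pair1_measurable.
  have mH' : measurable_fun setT (fun x => H (t, x)).
    by apply: (measurableT_comp mH); exact: pair1_measurable.
  have := boundV (fun x => expR (- (a * c)) * F (s, x)) (fun y => H (t, y)) K mF' mH'.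
  rewrite (_ : \int[P]_w (expR (- (a * c)) * F (s, V w)) = expR (- (a * c)) * phi s); last first.
    rewrite RintegralZl //.
    by apply: (@bounded_integrable _ _ _ _ _ K) => //; exact: msec.
  move=> h; rewrite mulrC mulrA; apply: h => //.
    move=> x; rewrite mulr_ge0 ?expR_ge0 //=; have /andP[_ FxK] := FK (s, x).
    by rewrite (le_trans _ FxK) // ler_piMl.
  move=> x y; rewrite -mulrA mulrC expRN -ler_pdivlMr ?invr_gt0 ?expR_gt0 // invrK.
  by rewrite -expRD addrC -mulrDr.
rewrite addrC expRD; apply: (@one_point_inequality _ _ _ P a (expR C) K (b \o U) (tau \o U)
    (phi \o U) (eta \o U)) => //=.
- exact: expR_gt0.
- by move=> w y; exact: tilt_tau.
- move=> w; rewrite -[leRHS]mulr1 -expR0 -(mulr0 a); apply: section_bound => // x y.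
  by have := FH (U w, x) (U w, y); rewrite /= eqxx.
- move=> w w'; apply: section_bound => // x y; apply: le_trans (FH _ _) _.
  rewrite ler_expR ler_pM2l // lerD2r /=; case: ifP => // _; exact: b0.
Qed.

(** The inductive step bounds the pair of head and tail; this transports the bound to the tuple, [g]
    being the cons map. *)
Lemma two_function_bound_eq d (T : measurableType d) (R : realType)
    (P : probability T R) d1 d2 (S1 : measurableType d1) (S2 : measurableType d2)
    (V : {mfun T >-> S1}) (W : {mfun T >-> S2}) (g : S1 -> S2)
    (dist1 : S1 -> S1 -> R) (dist2 : S2 -> S2 -> R) (a C : R) :
  0 <= a -> measurable_fun setT g -> (forall w, W w = g (V w)) ->
  (forall x y, dist2 (g x) (g y) <= dist1 x y) ->
  two_function_bound P V dist1 a C -> two_function_bound P W dist2 a C.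
Proof.
move=> a0 mg WE dist21 boundV F H K mF mH FK HK FH.
have -> : \int[P]_w F (W w) = \int[P]_w (F \o g) (V w).
  by apply: eq_Rintegral => w _; rewrite WE.
have -> : \int[P]_w H (W w) = \int[P]_w (H \o g) (V w).
  by apply: eq_Rintegral => w _; rewrite WE.
apply: (boundV _ _ K) => //.
- exact: measurableT_comp.
- exact: measurableT_comp.
- by move=> x /=; exact: FK.
- by move=> x /=; exact: HK.
- by move=> x y /=; apply: le_trans (FH _ _) _; rewrite ler_expR ler_wpM2l.
Qed.

Definition weighted_hamming (R : realType) (n : nat) (b : R -> R) (x y : n.-tuple R) : R :=
  \sum_(i < n) (if tnth x i == tnth y i then 0 else b (tnth x i)).

Lemma two_function_bound_sample d (T : measurableType d) (R : realType)
    (P : probability T R) (a : R) (b tau : R -> R) (n : nat) (X : 'I_n -> {RV P >-> R}) :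
  0 < a -> (forall s, 0 <= b s) ->
  (forall s y, 0 <= y <= b s -> tilt a y <= tau s) ->
  (forall i, P.-integrable setT (EFin \o (tau \o X i))) ->
  mutually_independent X ->
  two_function_bound P (sample X) (weighted_hamming b) a
    (\sum_(i < n) \int[P]_w tau (X i w)).
Proof.
move=> a0 b0 tilt_tau; elim: n => [|n IHn] in X *; move=> itau indX.
  (* Without coordinates there is a single point, at distance 0 from itself. *)
  move=> F H K _ _ _ _ FH; rewrite big_ord0 expR0.
  have -> : \int[P]_w F (sample X w) = F [tuple].
    by under eq_Rintegral => w _ do rewrite tuple0; rewrite Rintegral_probability_cst.
  have -> : \int[P]_w H (sample X w) = H [tuple].
    by under eq_Rintegral => w _ do rewrite tuple0; rewrite Rintegral_probability_cst.
  by have := FH [tuple] [tuple]; rewrite /weighted_hamming big_ord0 mulr0 expR0.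
pose V : {mfun T >-> n.-tuple R} := sample (fun i => X (lift ord0 i)).
have mW : measurable_fun setT (fun w => (X ord0 w, V w)).
  by apply/measurable_fun_pair; exact: measurable_funPT.
pose W : {mfun T >-> (R * n.-tuple R)%type} := HB.pack (fun w => (X ord0 w, V w))
  (isMeasurableFun.Build _ _ _ _ _ mW).
have boundV := IHn _ (fun i => itau (lift ord0 i)) (mutually_independent_tail indX).
have boundW :=
  two_function_bound_prod (W := W) a0 b0 tilt_tau (itau ord0)
    (fun A B mA mB => head_tail_independent indX mA mB) (fun w => erefl) boundV.
rewrite big_ord_recl.
pose g (p : R * n.-tuple R) : n.+1.-tuple R := [tuple of p.1 :: p.2].
refine (two_function_bound_eq (W := sample X) (g := g) (ltW a0) _ _ _ boundW).
- exact: measurable_cons.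
- move=> w; apply: eq_from_tnth => i; rewrite tnth_mktuple /=.
  case: (unliftP ord0 i) => [j ->|->]; last by rewrite tnth0.
  by rewrite tnthS tnth_mktuple.
- move=> x y; rewrite /weighted_hamming big_ord_recl /= !tnth0.
  by under eq_bigr do rewrite !tnthS.
Qed.

(** * Measurability of the number of bins *)

Definition unit_cube (R : realType) (n : nat) : set (n.-tuple R) :=
  box (fun=> [set` `[0 : R, 1]]).

Lemma unit_cubeP (R : realType) (n : nat) (t : n.-tuple R) :
  unit_cube t <-> forall i, 0 <= tnth t i <= 1.
Proof. by split => h i; have := h i; rewrite /= in_itv. Qed.

Lemma measurable_box (R : realType) (n : nat) (C : 'I_n -> set R) :
  (forall i, measurable (C i)) -> measurable (box C).
Proof.
by move=> mC; rewrite measurable_tuple_box; apply: sub_sigma_algebra; exists C.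
Qed.

(** The set is a finite union, over the assignments [f], of finite intersections of sets given by
    one linear inequality each. *)
Lemma measurable_packable (R : realType) (n k : nat) :
  measurable [set t : n.-tuple R | packable (tnth t) k].
Proof.
pose load (f : {ffun 'I_n -> 'I_k}) j (t : n.-tuple R) :=
  \sum_(i < n) (if f i == j then tnth t i else 0).
have mload f j : measurable [set t | load f j t <= 1].
  have -> : [set t | load f j t <= 1] = setT `&` (fun t => load f j t <= 1) @^-1` [set true].
    by rewrite setTI; apply/seteqP; split.
  apply: measurable_fun_ler => //.
  by apply: measurable_sum => i; case: (f i == j) => //; exact: measurable_tnth.
rewrite (_ : [set t | _] = \bigcup_(f in setT) \bigcap_(j in setT) [set t | load f j t <= 1]).
  apply: fin_bigcup_measurable => [|f _]; first exact: finite_finset.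
  by apply: fin_bigcap_measurable => [|j _]; first exact: finite_finset.
apply/seteqP; split => t /=.
  move=> /existsP[f /forallP h]; exists f => // j _ /=.
  by rewrite /load -big_mkcond; exact: h.
move=> [f _ h]; apply/existsP; exists f; apply/forallP => j.
by have := h j; rewrite /= /load -big_mkcond; apply.
Qed.

Lemma bin_packing_number_leP (R : realType) (n k : nat) (x : 'I_n -> R) :
  (forall i, 0 <= x i <= 1) -> (bin_packing_number x <= k)%N = packable x k.
Proof.
move=> /bin_packing_numberP[px xmin]; apply/idP/idP; last exact: xmin.
by move=> /packable_leq; apply.
Qed.

(** On the cube, sublevel sets are packability sets; outside it [bin_packing_number] may be a
    default value, hence the intersection. A general [Q] is a countable union of levels. *)
Lemma measurable_bin_packing_number (R : realType) (n : nat) (Q : set nat) :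
  measurable (@unit_cube R n `&` [set t | Q (bin_packing_number (tnth t))]).
Proof.
have mcube : measurable (@unit_cube R n) by apply: measurable_box => i; exact: measurable_itv.
have mle k : measurable (@unit_cube R n `&` [set t | (bin_packing_number (tnth t) <= k)%N]).
  rewrite (_ : _ `&` _ = @unit_cube R n `&` [set t | packable (tnth t) k]).
    by apply: measurableI => //; exact: measurable_packable.
  by apply/seteqP; split => t /= [/[dup] /unit_cubeP ct ? h]; split => //; move: h;
    rewrite bin_packing_number_leP.
have meq k : measurable (@unit_cube R n `&` [set t | bin_packing_number (tnth t) = k]).
  case: k => [|k].
    rewrite (_ : [set t | _] = [set t | (bin_packing_number (tnth t) <= 0)%N]) //.
    by apply/seteqP; split => t /=; rewrite leqn0 => /eqP.
  have := measurableD (mle k.+1) (mle k); congr (measurable _).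
  apply/seteqP; split => t /=.
    move=> [[ct h1] h2]; split => //; apply/eqP; rewrite eqn_leq h1 ltnNge /=.
    by apply/negP => h; apply: h2.
  by move=> [ct ->]; rewrite ltnn; split; [split|case].
rewrite (_ : _ `&` _ = \bigcup_(k in Q)
    (@unit_cube R n `&` [set t | bin_packing_number (tnth t) = k])).
  by apply: bigcup_measurable => k _; exact: meq.
apply/seteqP; split => t /= => [[ct h]|[k Qk [ct Bk]]].
  by exists (bin_packing_number (tnth t)).
by rewrite Bk.
Qed.

(** * Bounds on products of probabilities *)

Lemma Rintegral_indic_comp d (T : measurableType d) (R : realType)
    (P : probability T R) d' (S : measurableType d') (V : {mfun T >-> S}) (A : set S) :
  measurable A -> \int[P]_w (\1_A (V w) : R) = fine (P (V @^-1` A)).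
Proof.
move=> mA; rewrite /Rintegral.
have mVA : measurable (V @^-1` A) by rewrite -[X in measurable X]setTI; exact: measurable_funPT.
by rewrite -[V @^-1` A]setIT -integral_indic.
Qed.

(** The two functions are [e] times the indicator of [S], and the indicator of [A]: the weighted
    distance is at least [be * r] between points of [S] and [A], which compensates the factor
    [e]. *)
Lemma probability_product_bound d (T : measurableType d) (R : realType)
    (P : probability T R) (n : nat) (X : 'I_n -> {RV P >-> R}) (S A : set (n.-tuple R))
    (a be c r : R) :
  0 < a -> 0 <= be ->
  (forall s y, 0 <= s <= 1 -> 0 <= y <= be * s -> tilt a y <= c * s ^+ 2) ->
  (forall i w, 0 <= X i w <= 1) -> mutually_independent X ->
  measurable S -> measurable A -> S `<=` @unit_cube R n ->
  (forall x y, S x -> A y -> r <= differing_sizes (tnth x) (tnth y)) ->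
  expR (a * (be * r)) * fine (P (sample X @^-1` S)) * fine (P (sample X @^-1` A)) `^ a
    <= expR (c * \sum_(i < n) \int[P]_w (X i w ^+ 2)).
Proof.
move=> a0 be0 tilt_le X01 indX mS mA Scube far.
(* The bound for samples needs the tilt inequality at every real [s], while [tilt_le] covers
   [[0, 1]]; clipping extends it and leaves the values of [X i] unchanged. *)
pose clip (s : R) := Num.min `|s| 1.
have clip01 s : 0 <= clip s <= 1 by rewrite /clip le_min normr_ge0 ler01 ge_min lexx orbT.
have clipE s : 0 <= s <= 1 -> clip s = s.
  by move=> /andP[s0 s1]; rewrite /clip ger0_norm // min_l.
pose b s := be * clip s.
pose tau s := c * clip s ^+ 2.
have iX2 i : P.-integrable setT (EFin \o (fun w => X i w ^+ 2)).
  apply: (@bounded_integrable _ _ _ _ _ 1).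
    by apply: measurable_funX; exact: measurable_funPT.
  by move=> w; have /andP[x0 x1] := X01 i w; rewrite exprn_ge0 //= exprn_ile1.
have tauE i w : tau (X i w) = c * X i w ^+ 2 by rewrite /tau clipE.
have itau i : P.-integrable setT (EFin \o (tau \o X i)).
  rewrite (_ : _ \o _ = EFin \o (fun w => c * X i w ^+ 2)).
    exact: (integrableZl measurableT c (iX2 i)).
  by apply/funext => w /=; rewrite tauE.
have b0 s : 0 <= b s by rewrite mulr_ge0 //; case/andP: (clip01 s).
have tilt_tau s y : 0 <= y <= b s -> tilt a y <= tau s by move=> /tilt_le; apply.
have := two_function_bound_sample a0 b0 tilt_tau itau indX.
have -> : \sum_(i < n) \int[P]_w tau (X i w) = c * \sum_(i < n) \int[P]_w (X i w ^+ 2).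
  rewrite mulr_sumr; apply: eq_bigr => i _; rewrite -RintegralZl //.
  by apply: eq_Rintegral => w _; rewrite tauE.
set e := expR (a * (be * r)).
move=> /(_ (fun x => e * \1_S x) (fun x => \1_A x) (Num.max e 1)).
rewrite RintegralZl //; last first.
  apply: (@bounded_integrable _ _ _ _ _ 1).
    by apply: measurableT_comp; [exact: measurable_indic|exact: measurable_funPT].
  by move=> w; rewrite indicE; case: (_ \in _); rewrite ?lexx ?ler01.
rewrite !Rintegral_indic_comp //; apply.
- by apply: measurable_funM; [exact: measurable_cst|exact: measurable_indic].
- exact: measurable_indic.
- move=> x; rewrite mulr_ge0 ?expR_ge0 //= le_max indicE.
  by case: (_ \in _); rewrite ?mulr1 ?lexx // mulr0 expR_ge0.
- move=> x; rewrite le_max indicE.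
  by case: (_ \in _); rewrite ?ler01 ?lexx ?orbT.
- move=> x y; rewrite !indicE.
  have [yA|_] := boolP (y \in A); last by rewrite powR0 ?gt_eqF // mulr0 expR_ge0.
  rewrite powR1 mulr1.
  have [xS|_] := boolP (x \in S); last by rewrite mulr0 expR_ge0.
  rewrite mulr1 ler_expR ler_pM2l //.
  apply: le_trans (_ : be * differing_sizes (tnth x) (tnth y) <= _).
    by rewrite ler_wpM2l // far // -inE.
  rewrite /differing_sizes big_mkcond mulr_sumr; apply: ler_sum => i _.
  case: eqVneq => _ /=; first by rewrite mulr0.
  rewrite /b clipE //; apply: (unit_cubeP x).1; apply: Scube; exact: set_mem.
Qed.

(** Here [r = (1 + u) / 2]. As [u > 0], an integer gap of at least [1 + u] is at least 2, so
    [bin_packing_number_sub_le] applies; [u = 0] would let in a gap of 1. *)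
Lemma probability_bin_packing_bound d (T : measurableType d) (R : realType)
    (P : probability T R) (n : nat) (X : 'I_n -> {RV P >-> R}) (Q Q' : set nat)
    (a be c u : R) :
  0 < a -> 0 <= be ->
  (forall s y, 0 <= s <= 1 -> 0 <= y <= be * s -> tilt a y <= c * s ^+ 2) ->
  (forall i w, 0 <= X i w <= 1) -> mutually_independent X -> 0 < u ->
  (forall k l, Q k -> Q' l -> 1 + u <= k%:R - l%:R) ->
  expR (a * (be * ((1 + u) / 2))) *
    fine (P [set w | Q (bin_packing_number (fun i => X i w))]) *
    fine (P [set w | Q' (bin_packing_number (fun i => X i w))]) `^ a
    <= expR (c * \sum_(i < n) \int[P]_w (X i w ^+ 2)).
Proof.
move=> a0 be0 tilt_le X01 indX u0 far.
have sampleE w : tnth (sample X w) = (fun i => X i w).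
  by apply/funext => i; rewrite tnth_mktuple.
have cubeX w : unit_cube (sample X w) by apply/unit_cubeP => i; rewrite sampleE.
have preE (q : set nat) : [set w | q (bin_packing_number (fun i => X i w))] =
    sample X @^-1` (@unit_cube R n `&` [set t | q (bin_packing_number (tnth t))]).
  apply/seteqP; split => w /=; rewrite sampleE; last by case.
  by move=> h; split => //; exact: cubeX.
rewrite !preE; apply: probability_product_bound => //.
- exact: measurable_bin_packing_number.
- exact: measurable_bin_packing_number.
- move=> x y [/unit_cubeP cx Qx] [/unit_cubeP cy Qy].
  have kl : 1 + u <=
      (bin_packing_number (tnth x))%:R - (bin_packing_number (tnth y))%:R := far _ _ Qx Qy.
  rewrite ler_pdivrMr // [leRHS]mulrC; apply: (le_trans kl).
  apply: bin_packing_number_sub_le => //; rewrite -(ltr_nat R) -natr1.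
  by lra.
Qed.

(** * Choice of parameters and the two tails *)

Unset Implicit Arguments.

Theorem theorem6p5 (R : realType) (d : measure_display) (T : measurableType d)
    (P : probability T R) (mu : probability R R)
    (N : nat) (hN : (0 < N)%N) (X : 'I_N -> {RV P >-> R})
    (X01 : forall i w, 0 <= X i w <= 1)
    (Xlaw : forall i, has_law (X i) mu)
    (Xindep : mutually_independent X)
    (M : R)
    (hM : is_median P (fun w => (bin_packing_number (fun i => X i w))%:R) M)
    (u : R) (u_ge0 : 0 <= u)
    (u_le : u <= 4 * Num.sqrt 2 * N%:R
                 * fine 'E_P[(fun w => X (Ordinal hN) w ^+ 2)]) :
  (P [set w | (1 + u <= `|(bin_packing_number (fun i => X i w))%:R - M|)%R]
   <= (8 * expR (- (u ^+ 2
         / (16 * N%:R * fine 'E_P[(fun w => X (Ordinal hN) w ^+ 2)]))))%:E)%E.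
Proof.
pose B w := bin_packing_number (fun i => X i w).
have mB (Q : set nat) : measurable [set w | Q (B w)].
  have sampleE w : tnth (sample X w) = (fun i => X i w).
    by apply/funext => i; rewrite tnth_mktuple.
  have mpre := @measurable_funPT _ _ _ _ (sample X) measurableT _
    (@measurable_bin_packing_number R N Q).
  congr (measurable _) : mpre; rewrite setTI; apply/seteqP; split => w /=.
    by rewrite sampleE => -[].
  move=> h; rewrite sampleE; split => //.
  by apply/unit_cubeP => i; rewrite sampleE.
set v := fine _.
(* For [u = 0] the right-hand side is 8. *)
have [u0|u_neq0] := eqVneq u 0.
  rewrite u0 expr0n mul0r oppr0 expR0 mulr1.
  apply: (le_trans (probability_le1 P _)); first by rewrite -u0; exact: (mB [set k | 1 + u <= `|k%:R - M|]).
  by rewrite lee_fin ler1n.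
have u_gt0 : 0 < u by rewrite lt_def u_neq0.
set s := N%:R * v.
(* A vanishing second moment would force [u <= 0]. *)
have s0 : 0 < s.
  rewrite ltNge; apply/negP => s_le0; move: u_le; rewrite leNgt => /negP; apply.
  apply: le_lt_trans u_gt0; rewrite -mulrA.
  by rewrite mulr_ge0_le0 // mulr_ge0 // sqrtr_ge0.
have vE i : \int[P]_w (X i w ^+ 2) = v.
  have law j : (\int[P]_w (X j w ^+ 2)%:E = \int[mu]_x (x ^+ 2)%:E)%E.
    have m2 : measurable_fun setT (fun x : R => (x ^+ 2)%:E).
      by apply/measurable_EFinP; exact: measurable_funX.
    rewrite -(ge0_integral_distribution (X j) m2); last by move=> y; rewrite lee_fin sqr_ge0.
    by apply: eq_measure_integral => A mA _; exact: Xlaw.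
  by rewrite /v unlock /Rintegral !law.
have sumE : \sum_(i < N) \int[P]_w (X i w ^+ 2) = s.
  by under eq_bigr do rewrite vE; rewrite sumr_const card_ord -mulr_natl.
have s40 : 0 < 4 * s by lra.
(* This [lam] minimizes [lam ^+ 2 * s - lam * u / 2]; the minimum is [- (lam ^+ 2 * s)], that is
   [- (u ^+ 2 / (16 * s))]. *)
pose lam := u / (4 * s).
have lam0 : 0 < lam by rewrite divr_gt0.
have uE : u = 4 * lam * s by rewrite /lam; field; rewrite gt_eqF.
(* This is the upper bound assumed on [u]. *)
have lam2 : lam ^+ 2 <= 2.
  rewrite -[leRHS](sqr_sqrtr (ler0n R 2)) ler_pXn2r ?nnegrE ?sqrtr_ge0 ?(ltW lam0) //.
  by rewrite /lam ler_pdivrMr // mulrA [_ * 4]mulrC /s mulrA.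
have expE : u ^+ 2 / (16 * N%:R * v) = lam ^+ 2 * s.
  by rewrite -mulrA -/s uE; field; rewrite gt_eqF.
have finP (Q : set nat) : P [set w | Q (B w)] = (fine (P [set w | Q (B w)]))%:E.
  by rewrite fineK // fin_num_measure.
have fine_ge (Q : set nat) (x : R) :
    (x%:E <= P [set w | Q (B w)])%E -> x <= fine (P [set w | Q (B w)]).
  by rewrite finP lee_fin.
have lamw (t y : R) : 0 <= t <= 1 -> 0 <= y <= lam * t -> y ^+ 2 <= lam ^+ 2 * t ^+ 2.
  by move=> /andP[t0 t1] /andP[y0 yt]; rewrite -exprMn ler_pXn2r ?nnegrE // (le_trans y0).
have lamw2 (t : R) : 0 <= t <= 1 -> lam ^+ 2 * t ^+ 2 <= 2.
  move=> /andP[t0 t1]; apply: le_trans lam2; rewrite ler_piMr ?sqr_ge0 //.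
  by rewrite exprn_ile1.
set E := expR (- (lam ^+ 2 * s)).
set p1 := fine (P [set w | M + (1 + u) <= (B w)%:R]).
set p2 := fine (P [set w | (B w)%:R <= M - (1 + u)]).
(* With [a = m] and slope [lam / m], the exponent is [lam * ((1 + u) / 2)] whatever [m] is; the
   median event contributes [2 ^+ m]. *)
have upper (m : nat) : (0 < m)%N ->
    (forall t y, 0 <= t <= 1 -> 0 <= y <= lam / m%:R * t ->
       tilt m%:R y <= lam ^+ 2 * t ^+ 2) ->
    p1 <= 2 ^+ m * (expR (- (lam / 2)) * E).
  move=> m0 tiltm.
  have mR : 0 < m%:R :> R by rewrite ltr0n.
  have far k l : M + (1 + u) <= k%:R -> l%:R <= M -> 1 + u <= k%:R - l%:R :> R by lra.
  have := @probability_bin_packing_bound _ _ _ P _ X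
    [set k | M + (1 + u) <= k%:R] [set k | k%:R <= M] m%:R (lam / m%:R) (lam ^+ 2) u
    mR (divr_ge0 (ltW lam0) (ltW mR)) tiltm X01 Xindep u_gt0 far.
  rewrite sumE -/p1 => h.
  have med : 2^-1 <= fine (P [set w | (B w)%:R <= M]).
    by apply: (fine_ge [set k | k%:R <= M]); case: hM.
  have medm : 2^-1 ^+ m <= fine (P [set w | (B w)%:R <= M]) `^ m%:R.
    rewrite powR_mulrn ?fine_ge0 //; apply: lerXn2r => //; rewrite nnegrE ?fine_ge0 //.
  have {}h : expR (lam * ((1 + u) / 2)) * p1 * 2^-1 ^+ m <= expR (lam ^+ 2 * s).
    apply: le_trans h.
    rewrite (_ : m%:R * _ = lam * ((1 + u) / 2)); last by field; rewrite gt_eqF.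
    by rewrite ler_wpM2l // mulr_ge0 ?expR_ge0 // fine_ge0.
  move: h; rewrite exprVn ler_pdivrMr ?exprn_gt0 // -ler_pdivlMl ?expR_gt0 // => h.
  apply: (le_trans h); rewrite [leLHS]mulrA [leRHS]mulrC /E -expRN -!expRD ler_pM2r ?exprn_gt0 //.
  by rewrite ler_expR uE; lra.
(* The points needing more bins must come first, so the median event now plays the role of [Q] and
   the rare event carries the power [a = 1 / 2]. *)
have lower : p2 <= 4 * (expR (- (lam / 2)) * E).
  have half0 : 0 < 2^-1 :> R by rewrite invr_gt0.
  have tilth t y : 0 <= t <= 1 -> 0 <= y <= lam * t ->
      tilt 2^-1 y <= 2^-1 * lam ^+ 2 * t ^+ 2.
    move=> t01 yt; have y2 := lamw _ _ t01 yt; have /andP[y0 _] := yt.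
    apply: le_trans (tilt_half_le y0 (le_trans y2 (lamw2 _ t01))) _.
    by rewrite -mulrA ler_pM2l.
  have far k l : M <= k%:R -> l%:R <= M - (1 + u) -> 1 + u <= k%:R - l%:R :> R by lra.
  have := @probability_bin_packing_bound _ _ _ P _ X
    [set k | M <= k%:R] [set k | k%:R <= M - (1 + u)] 2^-1 lam (2^-1 * lam ^+ 2) u
    half0 (ltW lam0) tilth X01 Xindep u_gt0 far.
  rewrite sumE -/p2 => h.
  have med : 2^-1 <= fine (P [set w | M <= (B w)%:R]).
    by apply: (fine_ge [set k | M <= k%:R]); case: hM.
  have p20 : 0 <= p2 by exact: fine_ge0.
  (* The inequality bounds the square root of [p2]; squaring it doubles the halved exponents and
     turns the median factor 2 into 4. *)
  pose q := p2 `^ 2^-1.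
  have q0 : 0 <= q by exact: powR_ge0.
  have qE : q ^+ 2 = p2 by rewrite -powR_mulrn // -powRrM mulVf // powRr1.
  have {}h : expR (2^-1 * (lam * ((1 + u) / 2))) * 2^-1 * q <= expR (2^-1 * lam ^+ 2 * s).
    by apply: le_trans h; rewrite ler_wpM2r // ler_pM2l ?expR_gt0.
  move: h; rewrite mulrAC ler_pdivrMr // -ler_pdivlMl ?expR_gt0 // => h.
  have := @lerXn2r R 2 _ _ _ _ h; rewrite qE !nnegrE => /(_ q0) {}h.
  apply: (le_trans (h _)); first by rewrite mulr_ge0 ?invr_ge0 ?mulr_ge0 ?expR_ge0.
  rewrite [X in X ^+ 2]mulrA exprMn -expRN -expRD -expRM_natl [leLHS]mulrC.
  rewrite (_ : 2 ^+ 2 = 4); last by lra.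
  rewrite /E ler_pM2l // -expRD ler_expR uE; lra.
have union : fine (P [set w | 1 + u <= `|(B w)%:R - M|]) <= p1 + p2.
  rewrite -lee_fin EFinD /p1 /p2 -(finP [set k | M + (1 + u) <= k%:R])
    -(finP [set k | k%:R <= M - (1 + u)]) -(finP [set k | 1 + u <= `|k%:R - M|]).
  apply: (le_trans _ (measureU2 _ _ _)).
  - apply: le_measure; rewrite ?inE //; first by apply: measurableU; exact: mB.
    move=> w /=; rewrite ler_normr => /orP[] h; [left|right]; rewrite /=; lra.
  - exact: (mB [set k | M + (1 + u) <= k%:R]).
  - exact: (mB [set k | k%:R <= M - (1 + u)]).
rewrite (finP [set k | 1 + u <= `|k%:R - M|]) lee_fin expE -/E.
apply: (le_trans union).
have E0 : 0 < E by exact: expR_gt0.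
(* If [lam <= 1], then [2 * y <= lam * t <= 1] is in the range of [tilt2_le], and the factors are
   [4 + 4]. Otherwise [tilt3_le] takes over, with [8 + 4]. *)
have [lam1|lam1] := leP lam 1.
  have up := upper 2%N isT _.
  have {up} : p1 <= 4 * (expR (- (lam / 2)) * E).
    rewrite (_ : 4 = 2 ^+ 2) //; last by lra.
    apply: up => t y t01 yt.
    have /andP[y0 yl] := yt.
    have t2 : 2 * y <= lam * t by move: yl; lra.
    apply: le_trans (tilt2_le y0 _) _.
      have /andP[t0 t1] := t01; apply: le_trans t2 _; rewrite mulr_ile1 // ltW //.
    by apply: (lamw t (2 * y)) => //; rewrite mulr_ge0.
  have e1 : expR (- (lam / 2)) * E <= E.
    by rewrite ler_piMl ?(ltW E0) // expR_le1 oppr_le0 divr_ge0 // ltW.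
  lra.
have : p1 <= 8 * (expR (- (lam / 2)) * E).
  rewrite (_ : 8 = 2 ^+ 3) //; last by lra.
  apply: (upper 3%N isT) => t y t01 yt.
  have /andP[y0 yl] := yt.
  have y3 : (3 * y) ^+ 2 <= lam ^+ 2 * t ^+ 2.
    by apply: lamw => //; rewrite mulr_ge0 //=; move: yl; lra.
  by apply: le_trans (tilt3_le y0 (le_trans y3 (lamw2 _ t01))) _.
(* Since [expR 2^-1 >= 1 + 2^-1 = 3 / 2]; then [12 * (2 / 3) = 8]. *)
have e1 : expR (- (lam / 2)) * E <= 2 / 3 * E.
  rewrite ler_pM2r //; apply: le_trans (_ : expR (- 2^-1) <= _).
    by rewrite ler_expR; lra.
  rewrite expRN -[leRHS]invrK lef_pV2 ?posrE ?expR_gt0 ?invr_gt0 ?divr_gt0 //.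
  by apply: le_trans (expR_ge1Dx _); lra.
lra.
Qed.
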